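(* Let $x\in\mathcal X$, and let $\mathcal D$ be a convex and weakly compact ambiguity set of probability measures on $(\mathcal S,\mathcal F)$, where $\mathcal S$ is a compact metric space (the support set of $\xi$) and $\mathcal F$ is its Borel $\sigma$-algebra. Then the worst-case second-stage expected cost satisfies $$\sup_{F\in\mathcal D}\mathbb E_F[\Psi(x,\xi)]=\min_{\lambda\ge 0}\ \sup_{F\in\mathcal D}\mathbb E_F[\Phi_\lambda(x,\xi)].$$
   Context: Setting. $\mathcal X\subseteq\{0,1\}^d$ is the leader's feasible set, $\xi$ is a random vector with values in $\mathcal S\subseteq\mathbb R^k$, and $\mathbb E_F$ is expectation when $\xi$ has distribution $F$. $A\in\mathbb R^{m\times n}$. The data are affine in $\xi$: $c(\xi)=C\xi+c_0$, $v(\xi)=V\xi+v_0$ with $C,V\in\mathbb R^{n\times k}$, $c_0,v_0\in\mathbb R^n$; $b_x(\xi)=B_x\xi+b_{x0}$ with $B_x=\sum_{i=1}^d B_ix_i+B_0$, $b_{x0}=\sum_{i=1}^d b_ix_i+b_0$, $B_i\in\mathbb R^{m\times k}$, $b_i\in\mathbb R^m$ ($i=0,\dots,d$). Standing assumptions. (1) For every $F\in\mathcal D$ and $x\in\mathcal X$, $c(\xi),v(\xi),b_x(\xi)$ are square-integrable with respect to $F$. (2) Relatively complete recourse: for every $x\in\mathcal X$ and every $F\in\mathcal D$, the set $\{y\in\mathbb R^n: Ay\le b_x(\xi)\}$ is nonempty and bounded almost surely. (The boundedness is equivalent to $\{y: Ay\le 0\}=\{0\}$, and to $\{A^\top p: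 p\ge 0,\ p\in\mathbb R^m\}=\mathbb R^n$.) Definitions. $\Omega(x,\xi)=\arg\min_y\{c(\xi)^\top y: Ay\le b_x(\xi)\}$ (set of all optimal solutions), $\Psi(x,\xi)=\max_{y\in\Omega(x,\xi)}v(\xi)^\top y$, and for $\lambda\ge0$ $$\Phi_\lambda(x,\xi)=\min_{p\in\mathbb R^m,\,y\in\mathbb R^n}\{b_x(\xi)^\top p+c(\xi)^\top y:\ A^\top p+\lambda c(\xi)=v(\xi),\ p\ge0,\ Ay\le\lambda b_x(\xi)\}.$$
   Formalization: The minimum over λ ≥ 0 is stated as an infimum, since attainment can fail: with 0 ≤ y ≤ 1, c(ξ)=ξ, v=1 and D = {uniform law on [0,1]}, E[Φ_λ] is positive for every λ but has infimum 0. *)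

(* Defs.v *)
From HB Require Import structures.
From mathcomp Require Import all_boot all_order all_algebra.
From mathcomp Require Import all_classical all_reals all_analysis.

Set Implicit Arguments.
Unset Strict Implicit.
Unset Printing Implicit Defensive.

Import Order.TTheory GRing.Theory Num.Theory.
Import numFieldNormedType.Exports.

Local Open Scope classical_set_scope.
Local Open Scope ring_scope.

(* MathComp-Analysis. *)

Definition dot (R : realType) (l : nat) (u w : 'cV[R]_l) : R :=
  (u^T *m w) ord0 ord0.

Definition cvle (R : realType) (l : nat) (u w : 'cV[R]_l) : Prop :=
  forall i, u i ord0 <= w i ord0.

(* Coefficients of the two-stage problem; B and b collect the matrices and
   vectors indexed by 1..d, while B0 and b0 are those of index 0. *)
Record problem (R : realType) (d k m n : nat) := Problem {
  mxA : 'M[R]_(m, n);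
  mxC : 'M[R]_(n, k);
  c0 : 'cV[R]_n;
  mxV : 'M[R]_(n, k);
  v0 : 'cV[R]_n;
  mxB : 'I_d -> 'M[R]_(m, k);
  mxB0 : 'M[R]_(m, k);
  vb : 'I_d -> 'cV[R]_m;
  vb0 : 'cV[R]_m }.

Section second_stage.
Context (R : realType) (d k m n : nat) (P : problem R d k m n).
Implicit Types (x : {ffun 'I_d -> bool}) (xi : 'cV[R]_k) (lam : R).

Definition cost xi : 'cV[R]_n := mxC P *m xi + c0 P.

Definition valuation xi : 'cV[R]_n := mxV P *m xi + v0 P.

Definition rhs_mx x : 'M[R]_(m, k) :=
  \sum_(i < d) (x i)%:R *: mxB P i + mxB0 P.

Definition rhs_cst x : 'cV[R]_m :=
  \sum_(i < d) (x i)%:R *: vb P i + vb0 P.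

Definition rhs x xi : 'cV[R]_m := rhs_mx x *m xi + rhs_cst x.

Definition feasible x xi : set 'cV[R]_n :=
  [set y | cvle (mxA P *m y) (rhs x xi)].

Definition Omega x xi : set 'cV[R]_n :=
  [set y | feasible x xi y /\
    forall z, feasible x xi z -> dot (cost xi) y <= dot (cost xi) z].

(* The values of the optimization problems are extended reals, so that they
   also make sense for the (negligible) xi where the problem is infeasible
   or unbounded. *)
Definition Psi x xi : \bar R :=
  ereal_sup [set (dot (valuation xi) y)%:E | y in Omega x xi].

Definition Phi_feasible lam x xi : set ('cV[R]_m * 'cV[R]_n) :=
  [set py | [/\ (mxA P)^T *m py.1 + lam *: cost xi = valuation xi,
                cvle 0 py.1 &
                cvle (mxA P *m py.2) (lam *: rhs x xi)]].

Definition Phi lam x xi : \bar R :=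
  ereal_inf [set (dot (rhs x xi) py.1 + dot (cost xi) py.2)%:E |
             py in Phi_feasible lam x xi].

End second_stage.

Definition borelcV (R : realType) (k : nat) :=
  g_sigma_algebraType (@open 'cV[R]_k).

(* Mixtures are compared on measurable sets only: a measure is represented by
   a function on all subsets, whose values on non-measurable sets are
   irrelevant. *)
Definition convex_prob (R : realType) (k : nat)
    (D : set (probability (borelcV R k) R)) : Prop :=
  forall F G t, D F -> D G -> 0 <= t <= 1 ->
  exists2 H, D H & forall E : set (borelcV R k), measurable E ->
    H E = (t%:E * F E + (1 - t)%:E * G E)%E.

Definition test_integrals (R : realType) (k : nat) (S : set 'cV[R]_k)
    (F : pprobability (borelcV R k) R) :
    prod_topology (fun _ : continuousType (subspace S) R => R) :=
  fun f => \int[F]_(xi in S) f xi.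

(* Weak topology of the space of Borel probability measures on the compact
   set S: the coarsest topology making F |-> \int_S f dF continuous for every
   continuous f : S -> R. *)
Definition weak_prob (R : realType) (k : nat) (S : set 'cV[R]_k) :=
  initial_topology (@test_integrals R k S).

Definition weakly_compact (R : realType) (k : nat) (S : set 'cV[R]_k)
    (D : set (probability (borelcV R k) R)) : Prop :=
  @compact (weak_prob S) D.

(* Main.v *)
(** Phi_lam is an exact penalty for the optimistic follower: for a feasible xi,
    duality gives Phi_lam(xi) = max over A y <= b of v^T y - lam (c^T y - phi),
    where phi is the follower's optimal value. It decreases in lam, dominates
    Psi, and equals Psi for lam large (depending on xi), the multiplier of the
    constraint c^T y <= phi in the dual of Psi being such a lam. Basic dual
    solutions are bounded linearly in the objective, so Phi_lam is continuous on
    the closed set of feasible xi; by Tietze's theorem F |-> E_F[Phi_lam] is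
    weakly continuous on D. If s < inf_lam sup_F E_F[Phi_lam], choose F_j in D
    with s <= E_{F_j}[Phi_j]. A cluster point F of (F_j) satisfies
    s <= E_F[Phi_j] for every j by monotonicity, and s <= E_F[Psi] follows by
    dominated convergence. *)
Require Import Defs.
From mathcomp Require Import all_boot all_order all_algebra.
From mathcomp Require Import all_classical all_reals all_analysis.
From mathcomp Require Import measurable_realfun ring lra.
Import Order.TTheory GRing.Theory Num.Theory.
Import numFieldNormedType.Exports.
Set Implicit Arguments.
Unset Strict Implicit.
Unset Printing Implicit Defensive.
Local Open Scope classical_set_scope.
Local Open Scope ring_scope.

(** * Dot product and componentwise order on column vectors *)

Section dot_theory.
Context (R : realType).

Lemma dotE l (u w : 'cV[R]_l) : dot u w = \sum_i u i ord0 * w i ord0.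
Proof. by rewrite /dot mxE; apply: eq_bigr => i _; rewrite !mxE. Qed.

Lemma dotC l (u w : 'cV[R]_l) : dot u w = dot w u.
Proof. by rewrite !dotE; apply: eq_bigr => i _; rewrite mulrC. Qed.

Lemma dotDl l (u v w : 'cV[R]_l) : dot (u + v) w = dot u w + dot v w.
Proof. by rewrite /dot linearD /= mulmxDl mxE. Qed.

Lemma dotZl l a (u w : 'cV[R]_l) : dot (a *: u) w = a * dot u w.
Proof. by rewrite /dot linearZ /= -scalemxAl mxE. Qed.

Lemma dotNl l (u w : 'cV[R]_l) : dot (- u) w = - dot u w.
Proof. by rewrite -scaleN1r dotZl mulN1r. Qed.

Lemma dotBl l (u v w : 'cV[R]_l) : dot (u - v) w = dot u w - dot v w.
Proof. by rewrite dotDl dotNl. Qed.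

Lemma dotDr l (u v w : 'cV[R]_l) : dot u (v + w) = dot u v + dot u w.
Proof. by rewrite dotC dotDl !(dotC u). Qed.

Lemma dotZr l a (u w : 'cV[R]_l) : dot u (a *: w) = a * dot u w.
Proof. by rewrite dotC dotZl dotC. Qed.

Lemma dotNr l (u w : 'cV[R]_l) : dot u (- w) = - dot u w.
Proof. by rewrite dotC dotNl dotC. Qed.

Lemma dotBr l (u v w : 'cV[R]_l) : dot u (v - w) = dot u v - dot u w.
Proof. by rewrite dotDr dotNr. Qed.

Lemma dot0l l (w : 'cV[R]_l) : dot 0 w = 0.
Proof. by rewrite /dot linear0 mul0mx mxE. Qed.

Lemma dot0r l (w : 'cV[R]_l) : dot w 0 = 0.
Proof. by rewrite dotC dot0l. Qed.

Lemma dot_trmx m n (A : 'M[R]_(m, n)) p y : dot (A^T *m p) y = dot p (A *m y).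
Proof. by rewrite /dot trmx_mul trmxK mulmxA. Qed.

Lemma dot_col m n (u u' : 'cV[R]_m) (w w' : 'cV[R]_n) :
  dot (col_mx u w) (col_mx u' w') = dot u u' + dot w w'.
Proof. by rewrite /dot tr_col_mx mul_row_col mxE. Qed.

Lemma dot_scalar (a c : R) : dot (a%:M : 'cV_1) (c%:M) = a * c.
Proof. by rewrite dotE big_ord_recl big_ord0 !mxE addr0. Qed.

Lemma dot_self_gt0 l (w : 'cV[R]_l) : w != 0 -> 0 < dot w w.
Proof.
move=> w0; rewrite lt_def; apply/andP; split; last first.
  by rewrite dotE sumr_ge0// => i _; rewrite -expr2 sqr_ge0.
apply: contra w0; rewrite dotE psumr_eq0; last first.
  by move=> i _; rewrite -expr2 sqr_ge0.
move=> /allP w0; apply/eqP/matrixP => i j; rewrite ord1 mxE.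
have := w0 i; rewrite mem_index_enum => /(_ isT).
by rewrite mulf_eq0 orbb => /eqP.
Qed.

Lemma ler_dot l (p u w : 'cV[R]_l) : cvle 0 p -> cvle u w -> dot p u <= dot p w.
Proof.
move=> p0 uw; rewrite !dotE; apply: ler_sum => i _; apply: ler_wpM2l => //.
by have := p0 i; rewrite mxE.
Qed.

Lemma cvle_scale l a (u v : 'cV[R]_l) :
  0 <= a -> cvle u v -> cvle (a *: u) (a *: v).
Proof. by move=> a0 uv i; rewrite !mxE ler_wpM2l. Qed.

Lemma cvle_col m n (u u' : 'cV[R]_m) (w w' : 'cV[R]_n) :
  cvle (col_mx u w) (col_mx u' w') <-> cvle u u' /\ cvle w w'.
Proof.
split=> [h|[hu hw] i].
  by split=> i; [have := h (lshift _ i)|have := h (rshift _ i)];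
    rewrite ?(col_mxEu, col_mxEd).
by case: (split_ordP i) => j ->; rewrite ?(col_mxEu, col_mxEd).
Qed.

Lemma cvle_scalar (a c : R) : cvle (a%:M : 'cV_1) c%:M <-> a <= c.
Proof.
by split=> [/(_ ord0)|ac i]; rewrite !mxE ?ord1 ?eqxx.
Qed.

Lemma cvle0_scalar (a : R) : cvle 0 (a%:M : 'cV_1) <-> 0 <= a.
Proof. by split=> [/(_ ord0)|ac i]; rewrite !mxE ?ord1 ?eqxx. Qed.

Lemma cvle_scalar0 (a : R) : cvle (a%:M : 'cV_1) 0 <-> a <= 0.
Proof. by split=> [/(_ ord0)|ac i]; rewrite !mxE ?ord1 ?eqxx. Qed.

Lemma mulrow_dot n (w z : 'cV[R]_n) : w^T *m z = (dot w z)%:M.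
Proof. by apply/matrixP=> i j; rewrite !ord1 [in RHS]mxE eqxx mulr1n. Qed.

End dot_theory.

(** * Theorems of the alternative *)

Section farkas.
Context (R : realType).

(* Gale's induction on the number of generators: when the functional z that
   separates w from the cone of the last generators is positive on the first
   one, everything is projected along that generator onto the kernel of z. *)
Lemma farkas m n (A : 'M[R]_(m, n)) (w : 'cV[R]_n) :
  (exists2 p : 'cV[R]_m, cvle 0 p & A^T *m p = w) \/
  (exists2 z : 'cV[R]_n, cvle (A *m z) 0 & 0 < dot w z).
Proof.
elim: m => [|m IH] in A w *.
  have [->|w0] := eqVneq w 0.
    by left; exists 0; [move=> i; rewrite !mxE|rewrite mulmx0].
  by right; exists w; [case|exact: dot_self_gt0].
move: A; rewrite -[m.+1]/(1 + m)%N => A; rewrite -[A]vsubmxK.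
set a := usubmx _; set B := dsubmx _.
have [[p p0 pw]|[z Bz wz]] := IH B w.
  left; exists (col_mx (0 : 'M[R]_1) p).
    rewrite -col_mx0.
    by apply/cvle_col; split=> // i; rewrite !mxE.
  by rewrite tr_col_mx mul_row_col mulmx0 add0r.
have [az|az] := leP (dot a^T z) 0.
  right; exists z => //.
  rewrite mul_col_mx -col_mx0; apply/cvle_col; split=> //.
  by rewrite -[a]trmxK mulrow_dot => i; rewrite !mxE !ord1 eqxx.
set t := dot a^T z in az.
pose B' := B - t^-1 *: (B *m z *m a).
have [[p p0 pw]|[y B'y wy]] := IH B' (w - (dot w z / t) *: a^T).
  left; exists (col_mx (dot w z / t - t^-1 * dot p (B *m z))%:M p).
    rewrite -col_mx0; apply/cvle_col; split=> //.
    apply/cvle0_scalar; rewrite subr_ge0.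
    apply: (@le_trans _ _ 0); last by rewrite divr_ge0// ltW.
    rewrite pmulr_rle0 ?invr_gt0//.
    by apply: (le_trans (ler_dot p0 Bz)); rewrite dot0r.
  rewrite tr_col_mx mul_row_col mul_mx_scalar scalerBl.
  apply: (@addIr _ (- ((dot w z / t) *: a^T))).
  rewrite -pw addrAC (addrC (_ *: _)) addrK addrC.
  rewrite /B' linearB /= mulmxBl; congr (_ - _).
  rewrite !linearZ /= trmx_mul -scalemxAl -scalerA; congr (_ *: _).
  by rewrite -mulmxA mulrow_dot mul_mx_scalar dotC.
right; exists (y - (dot a^T y / t) *: z).
  rewrite mul_col_mx -col_mx0; apply/cvle_col; split.
    rewrite -[a]trmxK mulrow_dot trmxK; apply/cvle_scalar0.
    by rewrite dotBr dotZr -/t -mulrA mulVf ?gt_eqF// mulr1 subrr.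
  suff -> : B *m (y - (dot a^T y / t) *: z) = B' *m y by [].
  rewrite mulmxBr -scalemxAr /B' mulmxBl; congr (_ - _).
  rewrite -scalemxAl -!mulmxA mulmxA -[a in RHS]trmxK mulrow_dot.
  rewrite mul_mx_scalar scalerA.
  by rewrite mulrC.
move: wy; rewrite dotBl dotZl dotBr dotZr.
by rewrite (_ : dot w z / t * dot a^T y = dot a^T y / t * dot w z)//; ring.
Qed.

(** Homogenization: [farkas] for the block matrix with rows [(A, -b)] and [(0, -1)] and the target
    [(w, -M)]. The multiplier of the last row is the slack in [dot b p <= M]; the second alternative
    keeps the scale [t], which may be 0. *)
Lemma farkas_hom m n (A : 'M[R]_(m, n)) (b : 'cV[R]_m) (w : 'cV[R]_n) (M : R) :
  (exists p, [/\ cvle 0 p, A^T *m p = w & dot b p <= M]) \/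
  (exists z t, [/\ 0 <= t, cvle (A *m z) (t *: b) & t * M < dot w z]).
Proof.
have [[p p0]|[z]] :=
    farkas (block_mx A (- b) 0 (-1)%:M : 'M[R]_(m + 1, n + 1))
           (col_mx w (- M)%:M).
  rewrite -[p]vsubmxK -col_mx0 in p0 *; move/cvle_col: p0 => [p0 q0].
  rewrite tr_block_mx mul_block_col trmx0 mul0mx addr0 => /eq_col_mx[pw pM].
  left; exists (usubmx p); split=> //.
  have {pM}/matrixP/(_ ord0 ord0) := pM.
  rewrite tr_scalar_mx mul_scalar_mx linearN /= mulNmx mulrow_dot !mxE eqxx.
  rewrite !mulr1n.
  by have := q0 ord0; rewrite !mxE; lra.
rewrite -[z]vsubmxK mul_block_col mul0mx add0r -col_mx0 => /cvle_col[zb z0].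
set t := (dsubmx z) ord0 ord0.
have tE : dsubmx z = t%:M by rewrite -mx11_scalar.
rewrite tE dot_col dot_scalar in zb z0 * => wz.
right; exists (usubmx z), t; split.
- by have := z0 ord0; rewrite mul_scalar_mx !mxE !eqxx !mulr1n; lra.
- move=> i; have := zb i; rewrite mul_mx_scalar !mxE; lra.
- lra.
Qed.

(** With [w = 0] and [M = -1] the second alternative of [farkas_hom] forces [t > 0], so [z] can be
    rescaled. *)
Lemma farkas_affine m n (A : 'M[R]_(m, n)) (b : 'cV[R]_m) :
  (exists y, cvle (A *m y) b) \/
  (exists p, [/\ cvle 0 p, A^T *m p = 0 & dot b p < 0]).
Proof.
have [[p [p0 Ap bp]]|[z [t [t0 zb]]]] := farkas_hom A b 0 (-1).
  by right; exists p; split=> //; apply: (le_lt_trans bp); rewrite ltrN10.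
rewrite dot0l mulrN1 oppr_lt0 => {}t0; left; exists (t^-1 *: z).
rewrite -[b](scalerK (lt0r_neq0 t0)) -scalemxAr.
by apply: cvle_scale => //; rewrite invr_ge0 ltW.
Qed.

End farkas.

(** * Dual solutions bounded linearly in the objective *)

Section bounded_dual_solutions.
Context (R : realType) (m n : nat) (A : 'M[R]_(m, n)).

Definition polyhedron (b : 'cV[R]_m) : set 'cV[R]_n :=
  [set y | cvle (A *m y) b].

Definition norm1 l (u : 'cV[R]_l) : R := \sum_i `|u i ord0|.

Definition support l (u : 'cV[R]_l) : {set 'I_l} := [set i | u i ord0 != 0]%SET.

Definition trivial_recession := forall y : 'cV[R]_n, cvle (A *m y) 0 -> y = 0.

Lemma norm1N l (u : 'cV[R]_l) : norm1 (- u) = norm1 u.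
Proof. by apply: eq_bigr => i _; rewrite mxE normrN. Qed.

Lemma dot_le_norm1 l (p b : 'cV[R]_l) c :
  (forall i, `|p i ord0| <= c) -> dot b p <= norm1 b * c.
Proof.
move=> pc; rewrite dotE /norm1 mulr_suml ler_sum// => i _.
by rewrite (le_trans (ler_norm _))// normrM ler_wpM2l.
Qed.

Lemma weak_duality p b y :
  cvle 0 p -> polyhedron b y -> dot (A^T *m p) y <= dot b p.
Proof. by move=> p0 yb; rewrite dot_trmx (dotC b) ler_dot. Qed.

Lemma bounded_trivial_recession b :
  polyhedron b !=set0 -> bounded_set (polyhedron b) -> trivial_recession.
Proof.
move=> [y0 y0b] [M [_ bM]] z Az; apply/eqP/negPn/negP => z0.
(* [t] gives [t *: z] the norm [M' + |y0| + 1], so that [y0 + t *: z] leaves the ball of radius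
   [M']. *)
pose M' := `|M| + 1; pose t := (M' + `|y0| + 1) / `|z|.
have nz : 0 < `|z| by rewrite normr_gt0.
have t0 : 0 <= t by rewrite divr_ge0// !addr_ge0.
have : polyhedron b (y0 + t *: z).
  rewrite /polyhedron /= mulmxDr -scalemxAr => i; rewrite mxE -[leRHS]addr0.
  rewrite lerD// [leLHS]mxE mulr_ge0_le0//.
  by have := Az i; rewrite [leRHS]mxE.
have MM' : M < M' by rewrite (le_lt_trans (ler_norm M))// ltrDl.
move=> /(bM M' MM'); apply/negP; rewrite -ltNge.
have : `|t *: z| <= `|y0 + t *: z| + `|y0|.
  by rewrite -{1}[t *: z](addKr y0) addrC ler_normB.
rewrite normrZ ger0_norm// /t divfK ?gt_eqF//; lra.
Qed.

Lemma cone_surj w : trivial_recession -> exists2 p, cvle 0 p & A^T *m p = w.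
Proof.
move=> A0; have [//|[z /A0 ->]] := farkas A w.
by rewrite dot0r ltxx.
Qed.

(** The ratio test of the simplex method: [p] moves along a kernel vector, in the direction that
    does not increase the objective, until a coordinate vanishes. *)
Lemma support_reduction b p mu :
    (forall q, cvle 0 q -> A^T *m q = 0 -> 0 <= dot b q) ->
    cvle 0 p -> A^T *m mu = 0 -> mu != 0 -> support mu \subset support p ->
  exists p', [/\ cvle 0 p', A^T *m p' = A^T *m p, dot b p' <= dot b p &
                 support p' \proper support p].
Proof.
move=> b0 p0 Amu mu0 /fintype.subsetP mup.
(* [nu] is [mu] or [- mu]. If one of them has no positive entry, the other is nonnegative and [b0]
   settles the sign of its value. *)
have [nu [Anu bnu [i0 nui0] nup]] : exists nu, [/\ A^T *m nu = 0, 0 <= dot b nu,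
    exists i, 0 < nu i ord0 & forall i, nu i ord0 != 0 -> p i ord0 != 0].
  have mup' i : mu i ord0 != 0 -> p i ord0 != 0.
    by have := mup i; rewrite !inE.
  have AmuN : A^T *m (- mu) = 0 by rewrite mulmxN Amu oppr0.
  have mupN i : (- mu) i ord0 != 0 -> p i ord0 != 0.
    by rewrite mxE oppr_eq0; exact: mup'.
  have [[i mui]|muN] := pselect (exists i, 0 < mu i ord0); last first.
    have mu_le0 : cvle 0 (- mu).
      move=> i; rewrite !mxE oppr_ge0 leNgt; apply/negP => ?.
      by apply: muN; exists i.
    exists (- mu); split => //; first exact: b0.
    apply: contrapT => muN'; move/eqP: mu0; apply; apply/matrixP => i j.
    rewrite ord1 [RHS]mxE; apply/eqP; rewrite eq_le; apply/andP; split.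
      by rewrite leNgt; apply/negP => ?; apply: muN; exists i.
    rewrite -oppr_le0 leNgt; apply/negP => ?; apply: muN'; exists i.
    by rewrite mxE.
  have [bmu|bmu] := leP 0 (dot b mu); first by exists mu; split=> //; exists i.
  exists (- mu); split=> //; first by rewrite dotNr oppr_ge0 ltW.
  apply: contrapT => muN; move: bmu; rewrite ltNge => /negP; apply.
  apply: b0 => // j; rewrite mxE leNgt; apply/negP => ?; apply: muN; exists j.
  by rewrite mxE oppr_gt0.
have p0' i : 0 <= p i ord0 by have := p0 i; rewrite mxE.
(* The smallest ratio is the longest step keeping [p - t *: nu] nonnegative; its index [j] leaves
   the support. *)
case: (@Order.TotalTheory.arg_minP _ R _ i0 (fun i => 0 < nu i ord0)
  (fun i => p i ord0 / nu i ord0) nui0) => j nuj jmin.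
set t := p j ord0 / nu j ord0 in jmin.
have t0 : 0 <= t by rewrite divr_ge0// ltW.
exists (p - t *: nu); split.
- move=> i; rewrite !mxE subr_ge0.
  have [nui|nui] := ltP 0 (nu i ord0); first by rewrite -ler_pdivlMr// jmin.
  by rewrite (@le_trans _ _ 0)// mulr_ge0_le0.
- by rewrite mulmxBr -scalemxAr Anu scaler0 subr0.
- by rewrite dotBr dotZr gerBl mulr_ge0.
- apply/properP; split.
    apply/fintype.subsetP => i; rewrite !inE; apply: contra => /eqP pi0.
    have nui : nu i ord0 = 0.
      by apply/eqP; apply: contraT => /nup; rewrite pi0 eqxx.
    by rewrite !mxE pi0 nui mulr0 subrr.
  exists j; first by rewrite inE nup ?gt_eqF.
  by rewrite inE negbK !mxE /t divfK ?subrr// lt0r_neq0.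
Qed.

(** Linear independence of the rows of [A] indexed by [J]. *)
Definition independent (J : {set 'I_m}) :=
  forall mu, A^T *m mu = 0 -> support mu \subset J -> mu = 0.

(** Caratheodory's reduction: [support_reduction] is repeated as long as the support is dependent,
    and the support shrinks each time. *)
Lemma basic_solution b p :
    (forall q, cvle 0 q -> A^T *m q = 0 -> 0 <= dot b q) -> cvle 0 p ->
  exists p', [/\ cvle 0 p', A^T *m p' = A^T *m p, dot b p' <= dot b p &
                 independent (support p')].
Proof.
move=> b0; have [N] := ubnP #|support p|; elim: N p => // N IH p pN p0.
have [ind|] := pselect (independent (support p)); first by exists p.
move=> /existsNP[mu /not_implyP[Amu /not_implyP[mup /eqP mu0]]].
have [q [q0 Aq bq qp]] := support_reduction b0 p0 Amu mu0 mup.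
have [|p' [p'0 Ap' bp' ip']] := IH q _ q0.
  by rewrite (leq_trans (proper_card qp)).
by exists p'; split; rewrite // ?Ap'// (le_trans bp').
Qed.

(* A vector p supported on an independent set J is the image of A^T p under a
   linear map depending on J only; the constant sums over the finitely many
   sets J. *)
Lemma independent_bound :
  exists2 C, 0 <= C & forall p, independent (support p) ->
    forall i, `|p i ord0| <= C * norm1 (A^T *m p).
Proof.
(* [D J] projects onto the coordinates in [J]; [N J], built from a pseudo-inverse of the rows kept
   by [D J], recovers [p] from [A^T p]. *)
pose D (J : {set 'I_m}) : 'M[R]_m := diag_mx (\row_j (j \in J)%:R).
pose N J : 'M[R]_(m, n) := D J *m (pinvmx (D J *m A))^T.
exists (\sum_(J : {set 'I_m}) \sum_i \sum_j `|N J i j|).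
  by do 3 (apply: sumr_ge0 => ? _).
move=> p; set J := support p => indJ i.
have Dp : D J *m p = p.
  apply/matrixP => l j; rewrite ord1 mul_diag_mx !mxE inE.
  by case: eqVneq => [->|]; rewrite ?mulr0 ?mul1r.
have DT : (D J)^T = D J by rewrite tr_diag_mx.
have pE : N J *m (A^T *m p) = p.
  have sub : ((A^T *m p)^T <= D J *m A)%MS.
    by rewrite trmx_mul trmxK -{1}Dp trmx_mul DT -mulmxA submxMl.
  (* The difference of the two sides is supported on [J] and killed by [A^T], so independence makes
     it 0. *)
  apply/eqP; rewrite -subr_eq0; apply/eqP; apply: indJ; last first.
    apply/fintype.subsetP => l; apply: contraTT => lJ; rewrite inE negbK.
    rewrite /N -mulmxA mul_diag_mx !mxE (negbTE lJ) mul0r.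
    by move: lJ; rewrite inE negbK => /eqP ->; rewrite subr0.
  rewrite mulmxBr; apply/eqP; rewrite subr_eq0; apply/eqP/trmx_inj.
  by rewrite -[RHS](mulmxKpV sub) !trmx_mul !trmxK DT -!mulmxA.
rewrite -{1}pE mxE (le_trans (ler_norm_sum _ _ _))// mulr_sumr ler_sum// => j _.
rewrite normrM ler_wpM2r// (bigD1 J)//= (bigD1 i)//= (bigD1 j)//= -!addrA lerDl.
rewrite !addr_ge0// !sumr_ge0// => *; rewrite !sumr_ge0// => *.
by rewrite sumr_ge0.
Qed.

(* Reducing the dual solution of farkas_hom to an independent support makes the
   bound uniform over the right-hand sides. *)
Lemma bounded_dual : trivial_recession ->
  exists2 C, 0 <= C & forall w b M, polyhedron b !=set0 ->
    (forall y, polyhedron b y -> dot w y <= M) ->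
    exists p, [/\ cvle 0 p, A^T *m p = w, dot b p <= M &
                  forall i, `|p i ord0| <= C * norm1 w].
Proof.
move=> A0; have [C C0 CP] := independent_bound.
exists C => // w b M [y0 y0b] wM.
have b_ge0 q : cvle 0 q -> A^T *m q = 0 -> 0 <= dot b q.
  by move=> q0 Aq; have := weak_duality q0 y0b; rewrite Aq dot0l.
have [[p [p0 Ap bp]]|[z [t [t0 zb tw]]]] := farkas_hom A b w M.
  have [q [q0 Aq bq iq]] := basic_solution b_ge0 p0.
  exists q; split=> //; first by rewrite Aq.
  - exact: le_trans bp.
  - by rewrite -Ap -Aq; exact: CP.
(* For [t = 0] the vector [z] is a recession direction, hence 0; for [t > 0] the point [z / t] lies
   in the polyhedron with a value above [M]. *)
exfalso; move: t0; rewrite le_eqVlt => /predU1P[t0|t0].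
  move: zb tw; rewrite -t0 scale0r => /A0 ->.
  by rewrite dot0r mul0r ltxx.
have /wM : polyhedron b (t^-1 *: z).
  rewrite /polyhedron /= -[b](scalerK (lt0r_neq0 t0)) -scalemxAr.
  by apply: cvle_scale => //; rewrite invr_ge0 ltW.
by rewrite dotZr mulrC ler_pdivrMr// leNgt mulrC tw.
Qed.

End bounded_dual_solutions.

(** * Optimal values of linear programs as functions of their data *)

Section linear_programs.
Context (R : realType) (m n : nat) (A : 'M[R]_(m, n)).
Hypothesis A0 : trivial_recession A.
Implicit Types (b : 'cV[R]_m) (w : 'cV[R]_n).

(** A real supremum: bounded thanks to trivial recession, but a mere default on an empty polyhedron,
    hence the nonemptiness hypotheses below. *)
Definition lpmax w b : R := sup [set dot w y | y in polyhedron A b].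

Lemma lpmax_ub w b y : polyhedron A b y -> dot w y <= lpmax w b.
Proof.
move=> yb; apply: ub_le_sup; last by exists y.
have [p p0 <-] := cone_surj w A0.
by exists (dot b p) => _ [z zb <-]; exact: weak_duality.
Qed.

Lemma lpmax_le w b M : polyhedron A b !=set0 ->
  (forall y, polyhedron A b y -> dot w y <= M) -> lpmax w b <= M.
Proof.
move=> [y yb] wM; apply: ge_sup; first by exists (dot w y); exists y.
by move=> _ [z zb <-]; exact: wM.
Qed.

(** A Farkas certificate [(q, s)] against [A y <= b] and [dot w y >= M] would bound [dot w y]
    strictly below its supremum [M] if [s > 0], and refute feasibility if [s = 0]. *)
Lemma lpmax_attained w b : polyhedron A b !=set0 ->
  exists2 y, polyhedron A b y & dot w y = lpmax w b.
Proof.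
move=> b0; set M := lpmax w b.
have [[y]|[p [p0 Ap bp]]] :=
    farkas_affine (col_mx A (- w^T)) (col_mx b (- M)%:M).
  rewrite mul_col_mx mulNmx mulrow_dot => /cvle_col[yb].
  move=> /(_ ord0); rewrite !mxE !mulr1n lerN2 => Mw; exists y => //.
  by apply/le_anti; rewrite lpmax_ub.
exfalso; rewrite -[p]vsubmxK in p0 Ap bp.
set q := usubmx p in p0 Ap bp; set s := dsubmx p ord0 ord0.
have sE : dsubmx p = s%:M by rewrite -mx11_scalar.
rewrite sE -col_mx0 in p0 Ap bp; move: p0 => /cvle_col[q0 /cvle0_scalar s0].
move: Ap; rewrite tr_col_mx mul_row_col linearN /= trmxK mulNmx mul_mx_scalar.
move=> /subr0_eq Aq; move: bp; rewrite dot_col dot_scalar => bp.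
have sw y : polyhedron A b y -> s * dot w y <= dot b q.
  by move=> yb; rewrite -dotZl -Aq weak_duality.
have bq : dot b q < s * M by rewrite mulrC; move: bp; lra.
have [y yb] := b0.
move: s0; rewrite le_eqVlt => /predU1P[s0|s0].
  by have := sw y yb; rewrite -s0 mul0r; move: bq; rewrite -s0 mul0r; lra.
have : M <= dot b q / s.
  by apply: lpmax_le => // z /sw; rewrite ler_pdivlMr// mulrC.
by rewrite ler_pdivlMr// mulrC leNgt bq.
Qed.

Lemma lpmaxD w w' b : polyhedron A b !=set0 ->
  lpmax (w + w') b <= lpmax w b + lpmax w' b.
Proof.
by move=> b0; apply: lpmax_le => // y yb; rewrite dotDl lerD ?lpmax_ub.
Qed.

(** A dual vector for [w] and [b'] of size at most [C * norm1 w] remains dual feasible for [b],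
    which controls a change of [b]. A change of [w] is controlled by subadditivity and the bound
    [C * (norm1 w * norm1 b)]. *)
Lemma lpmax_lipschitz : exists2 C, 0 <= C &
  forall w w' b b', polyhedron A b !=set0 -> polyhedron A b' !=set0 ->
    `|lpmax w b - lpmax w' b'| <=
      C * (norm1 (w - w') * norm1 b' + norm1 w * norm1 (b - b')).
Proof.
have [C C0 CP] := bounded_dual A0; exists C => //.
have lpmax_rhs w b b' : polyhedron A b !=set0 -> polyhedron A b' !=set0 ->
    lpmax w b <= lpmax w b' + C * (norm1 w * norm1 (b - b')).
  move=> b0 b'0; have [|p [p0 Ap bp pC]] := CP w b' (lpmax w b') b'0.
    by move=> y; exact: lpmax_ub.
  apply: lpmax_le => // y yb; rewrite -{1}Ap (le_trans (weak_duality p0 yb))//.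
  rewrite -[X in dot X p](subrK b') dotDl addrC lerD//.
  by rewrite (le_trans (dot_le_norm1 _ pC))// mulrC mulrA.
have lpmax_norm w b : polyhedron A b !=set0 ->
    lpmax w b <= C * (norm1 w * norm1 b).
  move=> b0; have [|p [p0 Ap bp pC]] := CP w b (lpmax w b) b0.
    by move=> y; exact: lpmax_ub.
  apply: lpmax_le => // y yb; rewrite -{1}Ap (le_trans (weak_duality p0 yb))//.
  by rewrite (le_trans (dot_le_norm1 _ pC))// mulrC mulrA.
have lpmax_obj w w' b : polyhedron A b !=set0 ->
    lpmax w b <= lpmax w' b + C * (norm1 (w - w') * norm1 b).
  move=> b0; rewrite -[X in lpmax X _](subrK w') addrC.
  by rewrite (le_trans (lpmaxD _ _ b0))// lerD// lpmax_norm.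
move=> w w' b b' b0 b'0; rewrite ler_norml; apply/andP; split.
  have := lpmax_obj w' w b' b'0; have := lpmax_rhs w b' b b'0 b0.
  by rewrite -[w' - w]opprB -[b' - b]opprB !norm1N mulrDr; lra.
have := lpmax_obj w w' b' b'0; have := lpmax_rhs w b b' b0 b'0.
by rewrite mulrDr; lra.
Qed.

End linear_programs.

(** * Duality for the second stage at a fixed [xi] *)

Section second_stage_values.
Context (R : realType) (d k m n : nat) (P : problem R d k m n).
Context (x : {ffun 'I_d -> bool}) (xi : 'cV[R]_k).
Hypothesis A0 : trivial_recession (mxA P).
Let A := mxA P.
Let b := rhs P x xi.
Let c := cost P xi.
Let v := valuation P xi.

(* The maximum over A y <= b of v^T y - lam (c^T y - phi), the follower's
   optimal value being phi = - lpmax A (- c) b. *)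
Definition penalized (lam : R) : R :=
  lpmax A (v - lam *: c) b + lam * - lpmax A (- c) b.

Lemma follower_min y : feasible P x xi y -> - lpmax A (- c) b <= dot c y.
Proof. by move=> yb; rewrite lerNl -dotNl lpmax_ub. Qed.

Lemma OmegaP y : feasible P x xi !=set0 ->
  Omega P x xi y <-> feasible P x xi y /\ dot c y = - lpmax A (- c) b.
Proof.
move=> b0; split=> [[yb ymin]|[yb cy]]; split=> //.
  apply/le_anti; rewrite (follower_min yb) andbT.
  rewrite lerNr; apply: (lpmax_le b0) => z zb.
  by rewrite dotNl lerN2; exact: ymin.
by move=> z zb; rewrite cy lerNl -dotNl; exact: lpmax_ub.
Qed.

Lemma Omega_neq0 : feasible P x xi !=set0 -> Omega P x xi !=set0.
Proof.
move=> b0; have [y yb cy] := lpmax_attained A0 (- c) b0; exists y.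
by apply/OmegaP => //; split=> //; rewrite -cy dotNl opprK.
Qed.

(** The problem separates: duality turns the part in [p] into [lpmax A (v - lam *: c) b], and the
    part in [y] is the follower's problem scaled by [lam]. At [lam = 0] trivial recession leaves
    only [y = 0]. *)
Lemma PhiE lam : 0 <= lam -> feasible P x xi !=set0 ->
  Phi P lam x xi = (penalized lam)%:E.
Proof.
move=> lam0 b0; apply/le_anti/andP; split.
  have [C _ CP] := bounded_dual A0.
  have [|p [p0 Ap bp _]] := CP (v - lam *: c) b (lpmax A (v - lam *: c) b) b0.
    by move=> y; exact: lpmax_ub.
  have [y /OmegaP[]// yb cy] := Omega_neq0 b0.
  apply: (@le_trans _ _ (dot b p + dot c (lam *: y))%:E).
    apply: ereal_inf_lbound; exists (p, lam *: y) => //; split=> //=.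
      by rewrite Ap subrK.
    by rewrite -scalemxAr; exact: cvle_scale.
  by rewrite lee_fin dotZr cy lerD.
apply: le_ereal_inf_tmp => _ [[p y] /= [Ap p0 yb] <-]; rewrite lee_fin lerD//.
  apply: lpmax_le => // z zb.
  have -> : v - lam *: c = A^T *m p by rewrite /v -Ap addrK.
  exact: weak_duality.
move: lam0; rewrite le_eqVlt => /predU1P[lam0|lam0].
  move: yb; rewrite -lam0 scale0r => /A0 /= ->.
  by rewrite mul0r dot0r.
have : feasible P x xi (lam^-1 *: y).
  rewrite /feasible /= -[rhs _ _ _](scalerK (lt0r_neq0 lam0)) -scalemxAr.
  by apply: cvle_scale => //; rewrite invr_ge0 ltW.
by move=> /follower_min; rewrite dotZr mulrC ler_pdivlMr// mulrC.
Qed.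

(** The values at infeasible [xi], here and in the next two lemmas, serve the measurability of [Phi]
    and [Psi] on the whole space. *)
Lemma Phi_infeasible lam : 0 < lam -> feasible P x xi = set0 ->
  Phi P lam x xi = +oo%E.
Proof.
move=> lam0 b0; rewrite /Phi (_ : [set _ | _ in _] = set0) ?ereal_inf0//.
rewrite -subset0 => _ [[p y] /= [_ _ yb] _].
suff : feasible P x xi (lam^-1 *: y) by rewrite b0.
rewrite /feasible /= -[rhs _ _ _](scalerK (lt0r_neq0 lam0)) -scalemxAr.
by apply: cvle_scale => //; rewrite invr_ge0 ltW.
Qed.

(* By Farkas' lemma the dual problem is then unbounded. *)
Lemma Phi0_infeasible : feasible P x xi = set0 -> Phi P 0 x xi = -oo%E.
Proof.
move=> b0; have [[y yb]|[q [q0 Aq bq]]] := farkas_affine A b.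
  by suff : feasible P x xi y by rewrite b0.
have [p p0 Ap] := cone_surj v A0.
apply: oppe_inj; apply/eqyP => r _; rewrite leeNr -EFinN.
(* This makes [dot b (p + t *: q)] equal to [dot b p - |dot b p + r|], which is at most [- r]. *)
pose t := `|dot b p + r| / - dot b q.
have t0 : 0 <= t by rewrite divr_ge0// oppr_ge0 ltW.
apply: (@le_trans _ _ (dot b (p + t *: q) + dot c 0)%:E).
  apply: ereal_inf_lbound; exists (p + t *: q, 0) => //; split=> /=.
  - by rewrite mulmxDr -scalemxAr Aq scaler0 addr0 scale0r addr0.
  - move=> i; have := p0 i; have := q0 i; rewrite !mxE => qi pi.
    by rewrite addr_ge0// mulr_ge0.
  - by rewrite mulmx0 scale0r.
rewrite lee_fin dot0r addr0 dotDr dotZr /t invrN mulrN mulNr divfK ?lt_eqF//.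
by have := ler_norm (dot b p + r); lra.
Qed.

Lemma Psi_infeasible : feasible P x xi = set0 -> Psi P x xi = -oo%E.
Proof.
move=> b0; rewrite /Psi (_ : [set _ | _ in _] = set0) ?ereal_sup0//.
by rewrite -subset0 => t [y [yb _] _]; move: yb; rewrite b0.
Qed.

(** On feasible [y] the excess of [dot c y] over the follower's optimal value is nonnegative, so a
    larger penalty lowers every objective value. *)
Lemma le_penalized lam lam' : feasible P x xi !=set0 -> lam <= lam' ->
  penalized lam' <= penalized lam.
Proof.
move=> b0 lam_le; rewrite /penalized -lerBrDr; apply: lpmax_le => // y yb.
have := lpmax_ub A0 (v - lam *: c) yb; have := follower_min yb.
rewrite !dotBl !dotZl => h1 h2.
have : 0 <= (lam' - lam) * (dot c y - - lpmax A (- c) b).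
  by rewrite mulr_ge0// subr_ge0.
lra.
Qed.

(** The penalty term vanishes on [Omega]. *)
Lemma Psi_le_penalized lam : feasible P x xi !=set0 ->
  (Psi P x xi <= (penalized lam)%:E)%E.
Proof.
move=> b0; apply: ge_ereal_sup => _ [y /OmegaP[]// yb cy <-].
rewrite lee_fin /penalized -cy -lerBlDr -dotZl -dotBl.
exact: lpmax_ub.
Qed.

(* Duality for the follower's problem with the extra constraint
   c^T y <= phi, whose multiplier is the penalty. *)
Lemma exact_penalty : feasible P x xi !=set0 ->
  exists2 lam0, 0 <= lam0 & forall lam, lam0 <= lam ->
    Psi P x xi = (penalized lam)%:E.
Proof.
move=> b0; set phi := - lpmax A (- c) b.
(* Appending the row [c^T] with bound [phi] to [A] presents [Omega] as a polyhedron, so the results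
   on linear programs apply to [Psi]. *)
have EOmega y :
    polyhedron (col_mx A c^T) (col_mx b phi%:M) y <-> Omega P x xi y.
  rewrite /polyhedron /= mul_col_mx mulrow_dot cvle_col cvle_scalar OmegaP//.
  split=> -[yb cy]; split=> //; last by rewrite cy.
  by apply/le_anti; rewrite cy follower_min.
have A1 : trivial_recession (col_mx A c^T).
  move=> y; rewrite mul_col_mx -col_mx0 => /cvle_col[+ _]; exact: A0.
have Om0 : polyhedron (col_mx A c^T) (col_mx b phi%:M) !=set0.
  by have [y /EOmega] := Omega_neq0 b0; exists y.
have [C _ CP] := bounded_dual A1.
have [|p [p0 Ap bp _]] := CP v _ (lpmax (col_mx A c^T) v (col_mx b phi%:M)) Om0.
  by move=> y; exact: lpmax_ub.
rewrite -[p]vsubmxK in p0 Ap bp.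
set q := usubmx p in p0 Ap bp; set s := dsubmx p ord0 ord0.
have sE : dsubmx p = s%:M by rewrite -mx11_scalar.
rewrite sE -col_mx0 in p0 Ap bp; move: p0 => /cvle_col[q0 /cvle0_scalar s0].
move: Ap bp; rewrite tr_col_mx mul_row_col trmxK mul_mx_scalar => Ap.
rewrite dot_col dot_scalar => bp.
(* The multiplier [s] of the appended row is the threshold: since [A^T q = v - s c], weak duality
   bounds [penalized s] by [dot b q + phi * s]. *)
exists s => // lam slam; apply/le_anti; rewrite Psi_le_penalized//=.
have [y /EOmega yO yv] := lpmax_attained A1 v Om0.
apply: (@le_trans _ _ (dot v y)%:E); last by apply: ereal_sup_ubound; exists y.
rewrite lee_fin (le_trans (le_penalized b0 slam))// yv (le_trans _ bp)//.
rewrite /penalized -/phi [phi * s]mulrC lerD2r; apply: lpmax_le => // z zb.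
by rewrite -Ap addrK; exact: weak_duality.
Qed.

End second_stage_values.

(** * Continuity of linear programming values under affine data *)

Section continuity.
Context (R : realType).

Lemma continuous_sum (T : topologicalType) (I : finType) (f : I -> T -> R) :
  (forall i, continuous (f i)) -> continuous (fun t => \sum_i f i t).
Proof.
move=> cf t; apply: cvg_big => [|i _]; first exact: add_continuous.
exact: cf.
Qed.

Lemma continuous_mul (T : topologicalType) (f g : T -> R) :
  continuous f -> continuous g -> continuous (fun t => f t * g t).
Proof. by move=> cf cg t; apply: cvgM; [exact: cf|exact: cg]. Qed.

Lemma continuous_mulrl (T : topologicalType) (c : R) (f : T -> R) :
  continuous f -> continuous (fun t => c * f t).
Proof. by apply: continuous_mul => t; exact: cst_continuous. Qed.

Lemma continuous_add (T : topologicalType) (f g : T -> R) :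
  continuous f -> continuous g -> continuous (fun t => f t + g t).
Proof.
by move=> cf cg t; apply: (@continuousD R R^o); [exact: cf|exact: cg].
Qed.

Context (k : nat).

Lemma affine_continuous l (M : 'M[R]_(l, k)) (u : 'cV[R]_l) i :
  continuous (fun xi : 'cV[R]_k => (M *m xi + u) i ord0).
Proof.
rewrite (_ : (fun _ => _) = (fun xi : 'cV[R]_k => \sum_j M i j * xi j ord0) \+
    cst (u i ord0)); last by apply/funext => xi; rewrite !mxE.
apply: continuous_add; last by move=> xi; exact: cst_continuous.
apply: continuous_sum => j; apply: continuous_mulrl; exact: coord_continuous.
Qed.

Lemma norm1_continuous l (M : 'M[R]_(l, k)) (u u0 : 'cV[R]_l) :
  continuous (fun xi : 'cV[R]_k => norm1 (M *m xi + u - u0)).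
Proof.
apply: continuous_sum => i; under eq_fun do rewrite -addrA.
move=> xi; apply: (@continuous_comp _ _ _ _ (fun t : R => `|t|)).
  exact: affine_continuous.
exact: norm_continuous.
Qed.

Lemma dot_affine_continuous l (M : 'M[R]_(l, k)) (u q : 'cV[R]_l) :
  continuous (fun xi : 'cV[R]_k => dot (M *m xi + u) q).
Proof.
under eq_fun do rewrite dotC dotE.
apply: continuous_sum => i; apply: continuous_mulrl; exact: affine_continuous.
Qed.

Context (m n : nat) (A : 'M[R]_(m, n)).
Context (W : 'M[R]_(n, k)) (w0 : 'cV[R]_n) (B : 'M[R]_(m, k)) (b0 : 'cV[R]_m).

Let T : set 'cV[R]_k := [set xi | polyhedron A (B *m xi + b0) !=set0].

(** By Farkas' lemma nonemptiness is an intersection of closed conditions, one for each dual ray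
    [q]. *)
Lemma closed_nonempty_polyhedron : closed T.
Proof.
have -> : T = \bigcap_(q in [set q | cvle 0 q /\ A^T *m q = 0])
    [set xi | 0 <= dot (B *m xi + b0) q].
  rewrite eqEsubset; split=> xi; first by
    move=> [y yb] q [q0 Aq]; have := weak_duality q0 yb; rewrite Aq dot0l.
  move=> h; have [//|[q [q0 Aq]]] := farkas_affine A (B *m xi + b0).
  by rewrite ltNge h.
apply: closed_bigI => q _.
apply: (@closed_comp _ _ (fun xi : 'cV[R]_k => dot (B *m xi + b0) q)
  [set t | 0 <= t]).
  by move=> xi _; exact: dot_affine_continuous.
exact: closed_ge.
Qed.

Lemma lpmax_continuous : trivial_recession A ->
  {within T, continuous (fun xi => lpmax A (W *m xi + w0) (B *m xi + b0))}.
Proof.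
move=> A0; have [C C0 CP] := lpmax_lipschitz A0.
apply/subspace_continuousP => xi0 Txi0; apply/cvgrPdist_lt => e e0.
set w := W *m xi0 + w0; set b := B *m xi0 + b0.
(* The Lipschitz bound around [xi0], continuous and 0 at [xi0]. The term [- 0] only gives its factor
   the shape of [norm1_continuous]. *)
pose g (xi : 'cV[R]_k) :=
  C * (norm1 (W *m xi + w0 - w) * norm1 (B *m xi + b0 - 0)
       + norm1 w * norm1 (B *m xi + b0 - b)).
have g0 : g xi0 = 0.
  have z l (u : 'cV[R]_l) : norm1 (u - u) = 0.
    by rewrite subrr /norm1 big1// => i _; rewrite mxE normr0.
  by rewrite /g !z mul0r mulr0 addr0 mulr0.
have cg : continuous g.
  apply: continuous_mulrl; apply: continuous_add.
    by apply: continuous_mul; exact: norm1_continuous.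
  by apply: continuous_mulrl; exact: norm1_continuous.
have {}cg : g x @[x --> xi0] --> 0 by rewrite -g0; exact: cg.
have ge : \forall xi \near nbhs xi0, g xi < e by exact: (cvgr_lt _ cg).
rewrite near_withinE; apply: filterS ge => xi ge Txi.
apply: le_lt_trans ge; rewrite /g subr0.
have NB l (u v : 'cV[R]_l) : norm1 (u - v) = norm1 (v - u).
  by rewrite -norm1N opprB.
by rewrite [norm1 (_ - w)]NB [norm1 (_ - b)]NB; exact: CP.
Qed.

End continuity.

(** * Borel measurability and boundedness from relative continuity *)

Section borel.
Context (R : realType) (k : nat).

Lemma closed_borel_measurable (T : set 'cV[R]_k) :
  closed T -> measurable (T : set (borelcV R k)).
Proof.
move=> cT; rewrite -[T]setCK; apply: measurableC.
by apply: sub_sigma_algebra; exact: closed_openC.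
Qed.

Lemma within_continuous_borel_measurable (T : set 'cV[R]_k)
    (f : 'cV[R]_k -> R) :
  closed T -> {within T, continuous f} ->
  measurable_fun (T : set (borelcV R k)) (f : borelcV R k -> R).
Proof.
move=> cT cf; apply: (measurability _ (RGenCInfty.measurableE R)).
move=> _ [_ [a ->] <-].
have /closed_subspaceP[V cV VT] :
    closed (f @^-1` `[a, +oo[%classic : set (subspace T)).
  move/continuous_closedP : cf; apply; exact: interval_closed.
by rewrite setIC -VT; apply: closed_borel_measurable; exact: closedI.
Qed.

Lemma compact_image_bounded (T K : set 'cV[R]_k) (f : 'cV[R]_k -> R) :
    compact K -> K `<=` T -> {within T, continuous f} ->
  exists2 M, 0 < M & forall xi, K xi -> `|f xi| <= M.
Proof.
move=> cK KT /(continuous_subspaceW KT)/continuous_compact/(_ cK).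
move=> /compact_bounded[M [_ fM]]; exists (`|M| + 1); first by rewrite ltr_wpDl.
move=> xi Kxi; apply: (fM (`|M| + 1)); last by exists xi.
by rewrite (le_lt_trans (ler_norm _))// ltrDl.
Qed.

End borel.

(** * Regularity of [Phi] and [Psi] in [xi] *)

Section second_stage_regularity.
Context (R : realType) (d k m n : nat) (P : problem R d k m n).
Context (x : {ffun 'I_d -> bool}).
Hypothesis A0 : trivial_recession (mxA P).

Definition recourse_set : set 'cV[R]_k := [set xi | feasible P x xi !=set0].

Lemma closed_recourse_set : closed recourse_set.
Proof.
exact: (@closed_nonempty_polyhedron _ _ _ _ _ (rhs_mx P x) (rhs_cst P x)).
Qed.

Lemma penalized_continuous lam :
  {within recourse_set, continuous (fun xi => penalized P x xi lam)}.
Proof.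
rewrite /penalized; apply: continuous_add.
  have vcE xi : valuation P xi - lam *: cost P xi =
      (mxV P - lam *: mxC P) *m xi + (v0 P - lam *: c0 P).
    rewrite mulmxBl -scalemxAl /valuation /cost scalerDr opprD.
    by rewrite addrACA.
  under eq_fun do rewrite vcE.
  exact: lpmax_continuous.
apply: continuous_mulrl.
have cE xi : - cost P xi = (- mxC P) *m xi + (- c0 P).
  by rewrite mulNmx -opprD.
under eq_fun do rewrite cE -mulN1r.
apply: continuous_mulrl; exact: lpmax_continuous.
Qed.

Lemma infeasible_set0 xi : (~` recourse_set) xi -> feasible P x xi = set0.
Proof. by move=> /set0P/negP; rewrite negbK => /eqP. Qed.

Lemma measurable_recourse_set : measurable (recourse_set : set (borelcV R k)).
Proof. apply: closed_borel_measurable; exact: closed_recourse_set. Qed.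

Lemma measurable_piecewise (f g : borelcV R k -> \bar R) (c : \bar R) :
    measurable_fun (recourse_set : set (borelcV R k)) g ->
    (forall xi, recourse_set xi -> f xi = g xi) ->
    (forall xi, (~` recourse_set) xi -> f xi = c) ->
  measurable_fun setT f.
Proof.
move=> mg fg fc; rewrite -(setUv (recourse_set : set (borelcV R k))).
have mS := measurable_recourse_set.
apply/measurable_funU; [exact: mS|exact: measurableC|split].
  by apply: eq_measurable_fun mg => xi; rewrite inE => /fg ->.
apply: (eq_measurable_fun (cst c)); last exact: measurable_cst.
by move=> xi; rewrite inE => /fc ->.
Qed.

Lemma measurable_penalized lam : measurable_fun
  (recourse_set : set (borelcV R k))
  (fun xi : borelcV R k => (penalized P x xi lam)%:E).
Proof.
apply/measurable_EFinP; apply: within_continuous_borel_measurable.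
  exact: closed_recourse_set.
exact: penalized_continuous.
Qed.

Lemma measurable_Phi lam : 0 <= lam ->
  measurable_fun setT (Phi P lam x : borelcV R k -> \bar R).
Proof.
(* At infeasible [xi] the constant depends on [lam]: for [lam = 0] the constraint on [y] becomes
   [A y <= 0], which is satisfiable. *)
move=> lam0; apply: (measurable_piecewise
    (c := if lam == 0 then -oo%E else +oo%E) (measurable_penalized lam)) => xi.
  by move=> xiS; rewrite PhiE.
move=> /infeasible_set0 xi0; case: eqVneq => [->|lamN0].
  by rewrite Phi0_infeasible.
by rewrite Phi_infeasible// lt_def lamN0.
Qed.

Lemma penalized_cvg xi : recourse_set xi ->
  (penalized P x xi j%:R)%:E @[j --> \oo] --> Psi P x xi.
Proof.
move=> xiS; have [lam0 _ lamP] := exact_penalty A0 xiS.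
apply: cvg_near_cst; near=> j; rewrite -lamP//.
near: j; exact: nbhs_infty_ger.
Unshelve. all: by end_near. Qed.

(** On the recourse set [Psi] is the pointwise limit of the penalized values at integer
    penalties. *)
Lemma measurable_Psi : measurable_fun setT (Psi P x : borelcV R k -> \bar R).
Proof.
apply: (@measurable_piecewise _ (Psi P x) -oo%E) => //.
  apply: (emeasurable_fun_cvg (fun j (xi : borelcV R k) =>
    (penalized P x xi j%:R)%:E)).
    by move=> j; exact: measurable_penalized.
  by move=> xi; exact: penalized_cvg.
by move=> xi /infeasible_set0; exact: Psi_infeasible.
Qed.

(** The bound is uniform in [lam], as domination requires: the value at [lam = 0] bounds from above,
    and the value of an optimal follower solution from below. *)
Lemma penalized_bounded (K : set 'cV[R]_k) : compact K -> K `<=` recourse_set ->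
  exists2 M, 0 < M & forall lam xi, 0 <= lam -> K xi ->
    `|penalized P x xi lam| <= M.
Proof.
move=> cK KS.
have [M1 M10 M1P] := compact_image_bounded cK KS (@penalized_continuous 0).
have cv : {within recourse_set,
    continuous (fun xi => lpmax (mxA P) (- valuation P xi) (rhs P x xi))}.
  have vE xi : - valuation P xi = (- mxV P) *m xi + (- v0 P).
    by rewrite mulNmx -opprD.
  by under eq_fun do rewrite vE; exact: lpmax_continuous.
have [M2 M20 M2P] := compact_image_bounded cK KS cv.
exists (M1 + M2); first exact: addr_gt0.
move=> lam xi lam0 Kxi; rewrite ler_norml.
have xiS := KS _ Kxi; apply/andP; split; last first.
  rewrite (le_trans (le_penalized A0 xiS lam0))// (le_trans (ler_norm _))//.
  by rewrite (le_trans (M1P _ Kxi))// lerDl ltW.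
have [y yO] := Omega_neq0 A0 xiS.
have yb : feasible P x xi y by case: yO.
have : ((dot (valuation P xi) y)%:E <= (penalized P x xi lam)%:E)%E.
  apply: le_trans (Psi_le_penalized A0 lam xiS).
  by apply: ereal_sup_ubound; exists y.
rewrite lee_fin; apply: le_trans.
have := lpmax_ub A0 (- valuation P xi) yb; rewrite dotNl.
by have := ler_norm (lpmax (mxA P) (- valuation P xi) (rhs P x xi));
  have := M2P _ Kxi; lra.
Qed.

End second_stage_regularity.

(** * Weak continuity of integrals and cluster points *)

Section weak_topology.
Context (R : realType) (k : nat) (S : set 'cV[R]_k).

Lemma weak_integral_continuous (g : 'cV[R]_k -> R) : continuous g ->
  continuous (fun F : weak_prob S => \int[F]_(xi in S) g xi : R).
Proof.
move=> cg.
have cgS : continuous (g : subspace S -> R) by exact: continuous_subspaceT.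
pose h : continuousType (subspace S) R := mkcts cgS.
pose V (_ : continuousType (subspace S) R) : topologicalType := R.
have cf : continuous (@test_integrals R k S : weak_prob S -> prod_topology V).
  exact: initial_continuous.
have ch : continuous (@proj _ V h : prod_topology V -> R).
  exact: proj_continuous.
have : continuous ((@proj _ V h : prod_topology V -> R) \o
                   (@test_integrals R k S : weak_prob S -> prod_topology V)).
  by move=> F; apply: continuous_comp; [exact: cf|exact: ch].
exact.
Qed.

(* Dini's argument: a cluster point of the F_ j inherits every one of the
   decreasing closed conditions. *)
Lemma weakly_compact_dini (D : set (probability (borelcV R k) R))
    (g_ : nat -> 'cV[R]_k -> R) (s : R) :
    weakly_compact S D -> (forall j, continuous (g_ j)) ->
    (forall F i j, D F -> (i <= j)%N ->
      \int[F]_(xi in S) g_ j xi <= \int[F]_(xi in S) g_ i xi) ->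
    (forall j, exists2 F, D F & s <= \int[F]_(xi in S) g_ j xi) ->
  exists2 F, D F & forall j, s <= \int[F]_(xi in S) g_ j xi.
Proof.
move=> cD cg gmono gs.
have [F_ F_P] : exists F_ : nat -> weak_prob S, forall j,
    D (F_ j) /\ s <= \int[F_ j]_(xi in S) g_ j xi.
  have /choice[F_ F_P] : forall j, exists F : weak_prob S,
      D F /\ s <= \int[F]_(xi in S) g_ j xi.
    by move=> j; have [F DF sF] := gs j; exists F.
  by exists F_.
have [|F [DF clF]] := cD (F_ @ \oo) _.
  by exists 0%N => // j _; have [] := F_P j.
exists F => // i.
pose I (G : probability (borelcV R k) R) := \int[G]_(xi in S) g_ i xi.
have cK : closed [set G : weak_prob S | s <= I G].
  apply: (@closed_comp (weak_prob S) _ I [set t | s <= t]);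
    last exact: closed_ge.
  by move=> G _; exact: weak_integral_continuous.
(* By monotonicity the tail [F_ j], [j >= i], lies in this closed set, and so does the cluster
   point. *)
apply: cK => V /clF; apply.
exists i => // j ij; have [DFj sj] := F_P j.
by apply: (le_trans sj); exact: gmono.
Qed.

End weak_topology.

(** * Integrals against a measure concentrated on a set *)

Section concentrated_integral.
Local Open Scope ereal_scope.
Context (R : realType) (k : nat).
Context (F : probability (borelcV R k) R).

Lemma integral_concentrated (K : set (borelcV R k))
    (f : borelcV R k -> \bar R) :
    measurable K -> F (~` K) = 0 -> measurable_fun setT f ->
  \int[F]_xi f xi = \int[F]_(xi in K) f xi.
Proof.
move=> mK FK mf; rewrite [RHS]integral_mkcond; apply: ae_eq_integral => //.
  by apply/(measurable_restrictT _ mK); exact: measurable_funTS.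
exists (~` K); split=> //; first exact: measurableC.
by move=> xi /= h Kxi; apply: h => _; rewrite patchT// inE.
Qed.

End concentrated_integral.

(** * Expectations of [Phi] and [Psi] *)

Section expected_values.
Context (R : realType) (d k m n : nat) (P : problem R d k m n).
Context (x : {ffun 'I_d -> bool}) (S : set 'cV[R]_k).
Hypothesis A0 : trivial_recession (mxA P).
Hypothesis cS : compact S.

(** A compact set of full measure under the distributions considered; all expectations are reduced
    to it. *)
Let K : set 'cV[R]_k := S `&` recourse_set P x.

Lemma closed_support : closed S.
Proof. by apply: compact_closed cS; exact: norm_hausdorff. Qed.

Lemma compact_recourse : compact K.
Proof. by apply: compact_closedI => //; exact: closed_recourse_set. Qed.

Lemma measurable_recourse : measurable (K : set (borelcV R k)).
Proof.
apply: closed_borel_measurable.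
by apply: closedI; [exact: closed_support|exact: closed_recourse_set].
Qed.

(** Tietze's theorem: weak convergence tests functions continuous on all of [S], whereas the
    penalized value is known to be continuous only on [K]. *)
Lemma penalized_extension lam : 0 <= lam -> exists g : 'cV[R]_k -> R,
  [/\ continuous g, [bounded g xi | xi in setT] &
      forall xi, K xi -> g xi = penalized P x xi lam].
Proof.
move=> lam0.
have [M M0 MP] := penalized_bounded A0 compact_recourse (@subIsetr _ _ _).
have cK : closed K.
  by apply: closedI; [exact: closed_support|exact: closed_recourse_set].
have cp : {within K, continuous (fun xi => penalized P x xi lam)}.
  apply: continuous_subspaceW (@penalized_continuous _ _ _ _ _ P x A0 lam).
  exact: subIsetr.
have [|g [gE cg gM]] := continuous_bounded_extension
  (@pseudometric_normal R 'cV[R]_k) cK M0 cp.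
  by move=> xi Kxi; exact: MP.
exists g; split=> //; last by move=> xi Kxi; rewrite gE// inE.
exists M; split; first exact: gtr0_real.
by move=> N MN xi _ /=; rewrite (le_trans (gM xi))// ltW.
Qed.

Context (F : probability (borelcV R k) R).
Hypothesis FS : F S = 1%E.
Hypothesis Frec : {ae F, forall xi : borelcV R k, feasible P x xi !=set0}.

Lemma null_recourse : F (~` K) = 0%E.
Proof.
have mS : measurable (S : set (borelcV R k)).
  exact: closed_borel_measurable closed_support.
have mSC := measurableC mS.
rewrite setCI; apply: null_set_setU => //.
- exact: measurableC (measurable_recourse_set _ _).
- by have := probability_setC F mS; rewrite FS subee.
- have [N [mN FN0 sN]] := Frec.
  apply: (@subset_measure0 _ _ _ _ _ N) => //.
  exact: measurableC (measurable_recourse_set _ _).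
Qed.

Lemma measurable_penalized_recourse lam : measurable_fun (K : set (borelcV R k))
  (fun xi : borelcV R k => (penalized P x xi lam)%:E).
Proof.
apply: (measurable_funS (measurable_recourse_set P x)).
  exact: subIsetr.
exact: measurable_penalized.
Qed.

Lemma penalized_integrable lam : 0 <= lam ->
  F.-integrable K (fun xi => (penalized P x xi lam)%:E).
Proof.
move=> lam0; apply: (@measurable_bounded_integrable _ _ _ F
    (fun xi : borelcV R k => penalized P x xi lam) K).
- exact: measurable_recourse.
- rewrite (le_lt_trans (probability_le1 _ _))// ?ltry//.
  exact: measurable_recourse.
- apply/measurable_EFinP; exact: measurable_penalized_recourse.
have [M M0 MP] := penalized_bounded A0 compact_recourse (@subIsetr _ _ _).
exists M; split; first exact: gtr0_real.
by move=> N MN xi Kxi /=; rewrite (le_trans (MP _ _ lam0 Kxi))// ltW.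
Qed.

Lemma expected_PhiE lam : 0 <= lam ->
  (\int[F]_xi Phi P lam x xi = \int[F]_(xi in K) (penalized P x xi lam)%:E)%E.
Proof.
move=> lam0; rewrite (integral_concentrated measurable_recourse null_recourse).
  by apply: eq_integral => xi; rewrite inE => -[_ xiS]; rewrite PhiE.
exact: measurable_Phi.
Qed.

(** The values of the extension on [S] outside [K] are not seen by [F]. *)
Lemma expected_penalizedE lam g : continuous g -> [bounded g xi | xi in setT] ->
    (forall xi, K xi -> g xi = penalized P x xi lam) ->
  (\int[F]_(xi in K) (penalized P x xi lam)%:E)%E =
  (\int[F]_(xi in (S : set (borelcV R k))) g xi)%:E.
Proof.
move=> cg bg gE.
have mS : measurable (S : set (borelcV R k)).
  exact: closed_borel_measurable closed_support.
have mg : measurable_fun (S : set (borelcV R k)) (g : borelcV R k -> R).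
  apply: within_continuous_borel_measurable; first exact: closed_support.
  exact: continuous_subspaceT.
have ig :
    F.-integrable (S : set (borelcV R k)) (EFin \o (g : borelcV R k -> R)).
  apply: measurable_bounded_integrable => //.
    by rewrite (le_lt_trans (probability_le1 _ _))// ltry.
  by case: bg => M [Mr gM]; exists M; split=> // N /gM gN xi _; exact: gN.
rewrite /Rintegral fineK ?integrable_fin_num//.
rewrite [RHS]integral_mkcond.
rewrite (integral_concentrated measurable_recourse null_recourse).
  apply: eq_integral => xi; rewrite inE => Kxi.
  by rewrite patchT/= ?gE// inE; case: Kxi.
by apply/(measurable_restrictT _ mS); exact/measurable_EFinP.
Qed.

Lemma expected_PsiE :
  (\int[F]_xi Psi P x xi = \int[F]_(xi in K) Psi P x xi)%E.
Proof.
apply: (integral_concentrated measurable_recourse null_recourse).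
exact: measurable_Psi.
Qed.

(** Dominated convergence, with the constant bound uniform in [lam]. *)
Lemma expected_Psi_cvg : F.-integrable (K : set (borelcV R k)) (Psi P x) /\
  (\int[F]_(xi in K) (penalized P x xi j%:R)%:E)%E @[j --> \oo] -->
  (\int[F]_(xi in K) Psi P x xi)%E.
Proof.
have [M M0 MP] := penalized_bounded A0 compact_recourse (@subIsetr _ _ _).
have [] // := @dominated_convergence _ _ _ F K measurable_recourse
  (fun j xi => (penalized P x xi j%:R)%:E) (Psi P x) (cst M%:E).
- by move=> j; exact: measurable_penalized_recourse.
- by apply: measurable_funTS; exact: measurable_Psi.
- by apply: aeW => xi [_ xiS]; exact: penalized_cvg.
- by apply: finite_measure_integrable_cst; exact: measurable_recourse.
- by apply: aeW => xi j Kxi; rewrite lee_fin MP.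
Qed.

Lemma le_expected_penalized lam lam' : 0 <= lam -> lam <= lam' ->
  (\int[F]_(xi in K) (penalized P x xi lam')%:E <=
   \int[F]_(xi in K) (penalized P x xi lam)%:E)%E.
Proof.
move=> lam0 lam_le; apply: le_integral.
- exact: measurable_recourse.
- by apply: penalized_integrable; exact: le_trans lam_le.
- exact: penalized_integrable.
- by move=> xi; rewrite inE => -[_ xiS]; rewrite lee_fin le_penalized.
Qed.

Lemma expected_Psi_le lam : 0 <= lam ->
  (\int[F]_xi Psi P x xi <= \int[F]_xi Phi P lam x xi)%E.
Proof.
move=> lam0; rewrite expected_PsiE expected_PhiE//; apply: le_integral.
- exact: measurable_recourse.
- by have [] := expected_Psi_cvg.
- exact: penalized_integrable.
- by move=> xi; rewrite inE => -[_ xiS]; exact: Psi_le_penalized.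
Qed.

End expected_values.

(** * The minimax identity *)

Lemma le_of_real_lt (R : realType) (a b : \bar R) :
  (forall s : R, (s%:E < b)%E -> (s%:E <= a)%E) -> (b <= a)%E.
Proof.
case: b => [b| |] h.
- apply/lee_subgt0Pr => e e0; rewrite -EFinB; apply: h.
  by rewrite lte_fin gtrBl.
- by have -> : a = +oo%E by apply/eqyP => s _; apply: h; rewrite ltry.
- exact: leNye.
Qed.

Unset Implicit Arguments.

Theorem theorem1 (R : realType) (d k m n : nat) (P : problem R d k m n)
    (X : {set {ffun 'I_d -> bool}}) (S : set 'cV[R]_k)
    (D : set (probability (borelcV R k) R))
    (S_compact : compact S)
    (D_support : forall F, D F -> F S = 1%E)
    (D_convex : convex_prob D)
    (D_weakly_compact : weakly_compact S D)
    (cost_L2 : forall F, D F -> forall i : 'I_n,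
      (fun xi : borelcV R k => cost P xi i ord0) \in Lfun F 2%:E)
    (valuation_L2 : forall F, D F -> forall i : 'I_n,
      (fun xi : borelcV R k => valuation P xi i ord0) \in Lfun F 2%:E)
    (rhs_L2 : forall F x, D F -> x \in X -> forall i : 'I_m,
      (fun xi : borelcV R k => rhs P x xi i ord0) \in Lfun F 2%:E)
    (recourse : forall F x, D F -> x \in X ->
      {ae F, forall xi : borelcV R k,
        feasible P x xi !=set0 /\ bounded_set (feasible P x xi)})
    (x : {ffun 'I_d -> bool}) (x_in_X : x \in X) :
  ereal_sup [set (\int[F]_xi Psi P x xi)%E | F in D] =
  ereal_inf [set ereal_sup [set (\int[F]_xi Phi P lam x xi)%E | F in D]
            | lam in [set lam : R | 0 <= lam]].
Proof.
(* For empty [D] both suprema are [-oo], already at [lam = 0]. *)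
have [->|/set0P[F0 DF0]] := eqVneq D set0.
  rewrite !image_set0 ereal_sup0; apply/esym/eqP; rewrite -leeNy_eq.
  by apply: ereal_inf_lbound; exists 0; rewrite //= image_set0 ereal_sup0.
have ae_feasible F : D F ->
    {ae F, forall xi : borelcV R k, feasible P x xi !=set0}.
  by move=> DF; apply: filterS (recourse _ _ DF x_in_X) => xi [].
(* An almost sure event is nonempty, so some [xi] has a nonempty bounded feasible set. *)
have A0 : trivial_recession (mxA P).
  have F0T : (0 < F0 setT)%E by rewrite probability_setT.
  have [xi [xi0 bxi]] := @filter_ex _ _
    (ae_properfilter_algebraOfSetsType F0T) _ (recourse _ _ DF0 x_in_X).
  exact: bounded_trivial_recession xi0 bxi.
set supPsi := LHS; set infPhi := RHS.
have Psi_le_sup F : D F -> (\int[F]_xi Psi P x xi <= supPsi)%E.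
  by move=> DF; apply: ereal_sup_ubound; exists F.
have le_inf : (supPsi <= infPhi)%E.
  apply: ge_ereal_sup => _ [F DF <-].
  apply: le_ereal_inf_tmp => _ [lam lam0 <-].
  apply: le_trans (_ : _ <= \int[F]_xi Phi P lam x xi)%E _.
    exact: expected_Psi_le (D_support _ DF) (ae_feasible _ DF) _ lam0.
  by apply: ereal_sup_ubound; exists F.
apply/le_anti; rewrite le_inf/=.
(* Integer penalties suffice for the reverse inequality; each gets a continuous extension with the
   same expectations. *)
have /choice[g gP] : forall j : nat, exists g : 'cV[R]_k -> R,
    [/\ continuous g, [bounded g xi | xi in setT] &
        forall xi, (S `&` recourse_set P x) xi -> g xi = penalized P x xi j%:R].
  by move=> j; exact: penalized_extension.
have cg j : continuous (g j) by have [] := gP j.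
have gE F j : D F ->
    (\int[F]_xi Phi P j%:R x xi =
     (\int[F]_(xi in (S : set (borelcV R k))) g j xi)%:E)%E.
  move=> DF; have [_ bg gK] := gP j.
  rewrite (expected_PhiE A0 S_compact (D_support _ DF) (ae_feasible _ DF))//.
  exact: expected_penalizedE (D_support _ DF) (ae_feasible _ DF) _ _ (cg j)
    bg gK.
have gmono F i j : D F -> (i <= j)%N ->
    \int[F]_(xi in (S : set (borelcV R k))) g j xi <=
    \int[F]_(xi in (S : set (borelcV R k))) g i xi.
  move=> DF ij; rewrite -lee_fin -!gE//.
  rewrite !(expected_PhiE A0 S_compact (D_support _ DF) (ae_feasible _ DF))//.
  apply: le_expected_penalized => //.
  by rewrite ler_nat.
(* Working with real [s] below the infimum covers infinite values as well. *)
apply: le_of_real_lt => s s_lt.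
have [j|F DF sF] := weakly_compact_dini D_weakly_compact cg gmono (s := s).
  have : (s%:E < ereal_sup [set (\int[F]_xi Phi P j%:R x xi)%E | F in D])%E.
    by apply: lt_le_trans s_lt _; apply: ereal_inf_lbound; exists j%:R => /=.
  by move=> /ereal_sup_gt[_ [F DF <-]]; rewrite gE// lte_fin => /ltW; exists F.
(* A single [F] satisfies the bound for every penalty [j], so the bound passes to the limit
   [Psi]. *)
apply: le_trans (Psi_le_sup _ DF).
have [_] := expected_Psi_cvg x A0 S_compact F.
rewrite -(expected_PsiE A0 S_compact (D_support _ DF) (ae_feasible _ DF)).
apply: cvge_ge; apply: nearW => j.
rewrite -(expected_PhiE A0 S_compact (D_support _ DF) (ae_feasible _ DF))//.
by rewrite gE// lee_fin.
Qed.
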